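(* Let $A\subseteq\mathbb{N}$ and let $n_1,\ldots,n_k\in\mathbb{N}$. The following properties are equivalent: (1) There exist pairwise disjoint infinite sets $B_1,\ldots,B_k\subseteq\mathbb{N}$ such that $$(B_1)^{n_1\oplus}+\cdots+(B_k)^{n_k\oplus}\subseteq A.$$ (2) There exist distinct non-principal ultrafilters $\mathcal{U}_1,\ldots,\mathcal{U}_k$ on $\mathbb{N}$ such that $$A\in\bigcap_{\varphi\in\Phi}\mathcal{U}_{\varphi(1)}\oplus\cdots\oplus\mathcal{U}_{\varphi(n)},$$ where $n=n_1+\cdots+n_k$, and $\Phi$ is the set of all (surjective) functions $\varphi:\{1,\ldots,n\}\to\{1,\ldots,k\}$ such that for every $s=1,\ldots,k$ the preimage $\varphi^{-1}(\{s\})$ contains exactly $n_s$ elements.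
   Context: $\mathbb{N}=\{1,2,3,\ldots\}$. For an infinite set $B\subseteq\mathbb{N}$ and $r\in\mathbb{N}$, $B^{r\oplus}=\{b_1+\cdots+b_r\mid b_1,\ldots,b_r\in B\text{ distinct}\}$. For sets $C_1,\ldots,C_k\subseteq\mathbb{N}$, $C_1+\cdots+C_k=\{c_1+\cdots+c_k\mid c_s\in C_s\text{ for }s=1,\ldots,k\}$. The pseudo-sum of ultrafilters $\mathcal{U},\mathcal{V}$ on $\mathbb{N}$ is the ultrafilter $\mathcal{U}\oplus\mathcal{V}$ on $\mathbb{N}$ defined by $A\in\mathcal{U}\oplus\mathcal{V}\iff\{n\in\mathbb{N}\mid A-n\in\mathcal{V}\}\in\mathcal{U}$, where $A-n=\{m\in\mathbb{N}\mid m+n\in A\}$. This operation is associative (but not commutative). *)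

(* Defs.v *)
From HB Require Import structures.
From mathcomp Require Import all_boot.
From mathcomp Require Import all_classical.

Set Implicit Arguments.
Unset Strict Implicit.
Unset Printing Implicit Defensive.

Local Open Scope classical_set_scope.

(* Positive natural numbers: the ambient type for sets and ultrafilters, so
   that ultrafilters live on {1, 2, 3, ...} and not on nat. *)
Record posnat := PosNat { nat_of_posnat :> nat; _ : 0 < nat_of_posnat }.

HB.instance Definition _ := [isSub for nat_of_posnat].
HB.instance Definition _ := [Countable of posnat by <:].

Lemma posnat_gt0 (n : posnat) : 0 < n.
Proof. by case: n. Qed.

Lemma posnat_add_gt0 (m n : posnat) : 0 < m + n.
Proof. by rewrite addn_gt0 posnat_gt0. Qed.

Definition posnat_add (m n : posnat) : posnat := PosNat (posnat_add_gt0 m n).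

(* The sums are computed in nat; for r > 0 (resp. k > 0) they are positive, so
   the witness x : posnat always exists. *)
Definition distinct_sums (r : nat) (B : set posnat) : set posnat :=
  [set x : posnat | exists b : 'I_r -> posnat,
     [/\ injective b, forall i, B (b i) & x = \sum_(i < r) b i :> nat]].

Definition sumset (k : nat) (C : 'I_k -> set posnat) : set posnat :=
  [set x : posnat | exists c : 'I_k -> posnat,
     (forall s, C s (c s)) /\ x = \sum_(s < k) c s :> nat].

Definition shift_set (A : set posnat) (n : posnat) : set posnat :=
  [set m | A (posnat_add m n)].

Definition pseudo_sum (U V : set_system posnat) : set_system posnat :=
  [set A | U [set n | V (shift_set A n)]].

Lemma pseudo_sumA : associative pseudo_sum.
Proof.
move=> U V W; apply/seteqP; rewrite /pseudo_sum /shift_set.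
have addA (A : set posnat) m n :
    [set l | A (posnat_add (posnat_add l m) n)] =
    [set l | A (posnat_add l (posnat_add m n))].
  apply/seteqP; split=> l /=; congr A; apply: val_inj; rewrite /= ?addnA //.
by split=> A /=; congr U; apply/seteqP; split=> n /=; congr V;
  apply/seteqP; split=> m /=; rewrite addA.
Qed.

Lemma pseudo_sum_ultra (U V : set_system posnat) :
  UltraFilter U -> UltraFilter V -> UltraFilter (pseudo_sum U V).
Proof.
move=> UU UV.
have FU : Filter U by exact: filter_filter.
have FV : Filter V by exact: filter_filter.
have PF : ProperFilter (pseudo_sum U V).
  split; last split.
  - move=> U0; apply: (@filter_not_empty _ U _); apply: (@filterS _ U) U0 => n.
    exact: (@filter_not_empty _ V _).
  - by apply: (@filterS _ U) filterT => n _; exact: (@filterT _ V).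
  - by move=> A B; apply: (@filterS2 _ U) => n; exact: (@filterI _ V).
  - move=> A B AB; apply: (@filterS _ U) => n.
    by apply: (@filterS _ V) => m; exact: AB.
split=> // G PG sub; apply/seteqP; split=> // A GA.
have [//|UnA] := in_ultra_setVsetC [set n | V (shift_set A n)] UU.
exfalso; have /sub GnA : pseudo_sum U V (~` A).
  apply: (@filterS _ U) UnA => n nV.
  by have [|] := in_ultra_setVsetC (shift_set A n) UV.
by apply: (@filter_not_empty _ G _); rewrite -(setICr A); exact: filterI.
Qed.

(* U_1 (+) (U_2 (+) ... (+) U_n); the bracketing is irrelevant by pseudo_sumA.
   The value on the empty sequence is a dummy: pseudo_sum has no unit here. *)
Fixpoint iter_pseudo_sum (Us : seq (set_system posnat)) : set_system posnat :=
  match Us with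
  | [::] => set0
  | [:: U] => U
  | U :: Us' => pseudo_sum U (iter_pseudo_sum Us')
  end.

Definition nonprincipal (U : set_system posnat) : Prop :=
  forall x : posnat, U <> principal_filter x.

(* Surjectivity is automatic, every n s being positive. *)
Definition Phi (k : nat) (n : 'I_k -> posnat) :
    set ('I_(\sum_(s < k) n s) -> 'I_k) :=
  [set phi | forall s : 'I_k, #|[pred i | phi i == s]| = n s].
Arguments Phi {k} n _.

(* Main.v *)
Require Import Defs.
From mathcomp Require Import all_boot.
From mathcomp Require Import all_classical.

Local Open Scope classical_set_scope.

(** Both conditions are conditions on finite lists of tagged points, where the
    tag of a point is the index of the block it belongs to. A sum of the left-hand
    side is the total of a list without repetitions in which the tag [s] occurs
    [n s] times (sumset_distinct_sumsP). Membership in an iterated pseudo-sum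
    unfolds to a sentence with nested quantifiers: for [U (phi 1)]-most [x1], for
    [U (phi 2)]-most [x2], and so on, [x1 + x2 + ...] is in [A]
    (iter_pseudo_sumE); the functions in [Phi n] become the words in which each
    letter [s] occurs [n s] times (bigcap_PhiP).

    From sets to ultrafilters, any nonprincipal ultrafilters [U s] containing
    [B s] will do. They are distinct because the [B s] are disjoint. In the nested
    sentence, [U s]-most points are in [B s] and differ from the finitely many
    points quantified before, so the points picked form a list of the above kind,
    whatever the order of the letters (sumset_most_sums).

    From ultrafilters to sets, the points [x 0], [x 1], ... are chosen one after
    the other, with tags running cyclically through the blocks. The invariant
    (extendible) is that every selection of the chosen points keeps the truncated
    sentence for every word [w] that completes it: for [U (w 1)]-most [y1], and so
    on, the selection together with [y1], [y2], ... sums into [A]. At the start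
    this is the hypothesis on [A], for all of [Phi n]. A new point with tag [s]
    must satisfy finitely many conditions, one for each selection and each
    completing word that begins with [s], and each holds for [U s]-most points
    (extendible_cons). All words are needed because the points of a sum may come
    from the blocks in any order. A complete selection has the empty completing
    word, so its sum is in [A] (extendible_total). *)

(** * Tagged lists and words *)

(** A word [w] over the indices records in which order the blocks are used;
    [has_counts n w] is the defining condition of [Phi n] on words. *)
Definition has_counts {k : nat} (n : 'I_k -> posnat) (w : seq 'I_k) : Prop :=
  forall s, count_mem s w = n s.

Definition total {k : nat} (l : seq ('I_k * posnat)) : nat :=
  \sum_(p <- l) p.2.

Lemma size_sum_count (k : nat) (w : seq 'I_k) :
  size w = \sum_(s < k) count_mem s w.
Proof.
elim: w => [|t w IHw] /=; first by rewrite big1.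
rewrite big_split /= -IHw (bigD1 t) //= eqxx big1 ?addn0 ?add1n // => s.
by rewrite eq_sym => /negPf ->.
Qed.

Lemma has_counts_nil (k : nat) (k_gt0 : (0 < k)%N) (n : 'I_k -> posnat) :
  ~ has_counts n [::].
Proof. by move=> n0; have := posnat_gt0 (n (Ordinal k_gt0)); rewrite -n0. Qed.

Lemma has_counts_size (k : nat) (n : 'I_k -> posnat) (w : seq 'I_k) :
  has_counts n w -> size w = \sum_(s < k) n s.
Proof. by move=> nw; rewrite size_sum_count; apply: eq_bigr => s _. Qed.

Lemma perm_has_counts (k : nat) (n : 'I_k -> posnat) (w w' : seq 'I_k) :
  perm_eq w w' -> has_counts n w -> has_counts n w'.
Proof. by move=> /permP ww' nw s; rewrite -nw ww'. Qed.

(** Grouping the summands, each tagged with its block, into one list replaces a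
    family of finite sequences by a single object that can be grown one entry at
    a time and cut down to sublists. Since an entry carries its tag, uniqueness
    of the list means distinctness within each block only. *)
Lemma sumset_distinct_sumsP (k : nat) (n : 'I_k -> posnat)
    (B : 'I_k -> set posnat) (x : posnat) :
  sumset (fun s => distinct_sums (n s) (B s)) x <->
  exists l : seq ('I_k * posnat),
    [/\ uniq l, forall p, p \in l -> B p.1 p.2,
        has_counts n (unzip1 l) & x = total l :> nat].
Proof.
split=> [[c [cB xE]]|[l [l_uniq lB ln xE]]].
- have [b bP] := fin_all_exists cB.
  exists [seq (s, b s i) | s <- enum 'I_k, i <- enum 'I_(n s)]; split.
  + apply: allpairs_uniq_dep => [|s _|]; try exact: enum_uniq.
    move=> [s i] [t j] _ _ /= [st]; move: j; case: _ / st => j.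
    by have [b_inj _ _] := bP s => /b_inj ->.
  + by move=> _ /allpairsPdep[s [i [_ _ ->]]] /=; have [_ bB _] := bP s.
  + move=> s; rewrite count_map count_flatten -map_comp sumnE big_map.
    rewrite big_enum /= (bigD1 s) //= big1 ?addn0.
      rewrite count_map; under eq_count do rewrite /= eqxx.
      by rewrite count_predT size_enum_ord.
    move=> t /negPf ts; rewrite count_map.
    by under eq_count do rewrite /= ts; rewrite count_pred0.
  + rewrite xE /total big_allpairs_dep big_enum /=; apply: eq_bigr => s _.
    by rewrite big_enum /=; have [_ _ ->] := bP s.
- pose f s := [seq p.2 | p <- l & p.1 == s].
  have f_size s : size (f s) == n s.
    rewrite size_map size_filter -(ln s) count_map; exact/eqP/eq_count.
  have Csum_gt0 s : 0 < \sum_(i < n s) tnth (Tuple (f_size s)) i.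
    rewrite (bigD1 (Ordinal (posnat_gt0 (n s)))) //= addn_gt0.
    by rewrite posnat_gt0.
  have f_sum s : \sum_(i < n s) tnth (Tuple (f_size s)) i =
      \sum_(p <- l | p.1 == s) p.2 :> nat.
    rewrite -[RHS]big_filter -(big_map snd predT (fun x : posnat => x : nat)).
    exact: esym (big_tuple _ _ (Tuple (f_size s)) predT (fun x => x : nat)).
  exists (fun s => PosNat (Csum_gt0 s)); split=> [s|].
    exists (tnth (Tuple (f_size s))); split=> [|i|].
    * apply/tuple_uniqP; rewrite map_inj_in_uniq ?filter_uniq //.
      move=> [u a] [v b]; rewrite !mem_filter /=.
      by move=> /andP[/eqP-> _] /andP[/eqP-> _] ->.
    * have /mapP[p] := mem_tnth i (Tuple (f_size s)).
      by rewrite mem_filter => /andP[/eqP ps /lB +] ->; rewrite ps.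
    * by [].
  rewrite xE /total (partition_big fst predT) //=.
  by apply: eq_bigr => s _; rewrite f_sum.
Qed.

(** * Iterated pseudo-sums as nested quantifiers *)

(** For [w = s1 ... sm] this reads: for [U s1]-most [x1], ..., for [U sm]-most
    [xm], [y + x1 + ... + xm] is in [A]. The accumulator [y] starts at [0], which
    is why [A] is a set of [nat]; it makes the empty word meaningful, so that
    inductions on words start there. *)
Fixpoint most_sums {k : nat} (U : 'I_k -> set_system posnat) (A : set nat)
    (w : seq 'I_k) (y : nat) : Prop :=
  if w is s :: w' then U s [set x : posnat | most_sums U A w' (y + x)]
  else A y.

Lemma iter_pseudo_sumE (k : nat) (U : 'I_k -> set_system posnat) (A : set nat)
    (s : 'I_k) (w : seq 'I_k) (y : nat) :
  iter_pseudo_sum [seq U t | t <- s :: w] [set x : posnat | A (y + x)] =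
  most_sums U A (s :: w) y.
Proof.
elim: w s y => [|t w IHw] s y //=.
rewrite /pseudo_sum /=; congr (U s); apply/funext => m /=.
rewrite -[RHS](IHw t (y + m)); apply: (congr1 (iter_pseudo_sum (U t :: map U w))).
by apply/funext => x /=; rewrite /shift_set /= addnAC addnA.
Qed.

(** A word with counts [n] has length [\sum_s n s], hence is the list of values of
    a unique function on that ordinal, which lies in [Phi n]. *)
Lemma bigcap_PhiP (k : nat) (k_gt0 : (0 < k)%N) (n : 'I_k -> posnat)
    (U : 'I_k -> set_system posnat) (A : set nat) :
  (\bigcap_(phi in Phi n) iter_pseudo_sum
    [seq U (phi i) | i <- enum 'I_(\sum_(s < k) n s)]) [set x : posnat | A x]
  <-> forall w, has_counts n w -> most_sums U A w 0.
Proof.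
have most w : has_counts n w ->
    iter_pseudo_sum [seq U t | t <- w] [set x : posnat | A x] =
    most_sums U A w 0.
  case: w => [nw|s w _]; last by rewrite -iter_pseudo_sumE.
  by have := has_counts_nil _ k_gt0 _ nw.
split=> [Aphi w nw|Aw phi nphi].
- rewrite -most //.
  have w_size : size w == \sum_(s < k) n s by rewrite (has_counts_size _ _ _ nw).
  pose phi := tnth (Tuple w_size).
  have phiE : [seq phi i | i <- enum 'I_(\sum_(s < k) n s)] = w.
    exact: (map_tnth_enum (Tuple w_size)).
  rewrite -phiE -map_comp; apply: Aphi => s.
  rewrite -(nw s) -[in RHS]phiE count_map cardE size_filter /=.
  by rewrite enumT.
- rewrite (map_comp U phi) most; last first.
    by move=> s; rewrite count_map -(nphi s) cardE size_filter enumT.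
  apply: Aw => s.
  by rewrite count_map -(nphi s) cardE size_filter enumT.
Qed.

(** * Nonprincipal ultrafilters *)

(** An ultrafilter that contains a singleton is principal, so a nonprincipal one
    contains the complement of every singleton, hence every cofinite set. *)
Lemma nonprincipal_notin (U : set_system posnat) (r : seq posnat) :
  UltraFilter U -> nonprincipal U -> U [set x | x \notin r].
Proof.
move=> UU Unp.
have FU : Filter U by exact: filter_filter.
elim: r => [|a r IHr]; first exact: filterS filterT.
suff Ua : U (~` [set a]).
  apply: filterS2 Ua IHr => x /= xa xr.
  by rewrite inE negb_or xr andbT; apply/eqP.
have [Ua|//] := in_ultra_setVsetC [set a] UU.
case: (Unp a); apply/seteqP; split=> C.
- move=> UC; apply/principal_filterP.
  by have [x [-> ]] := filter_ex (filterI Ua UC).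
- by move=> /principal_filterP Ca; apply: filterS Ua => _ ->.
Qed.

(** Extend the filter of the sets that contain all but finitely many points of
    [B]; it is proper because [B] is infinite. *)
Lemma infinite_nonprincipal (B : set posnat) : infinite_set B ->
  exists U : set_system posnat, [/\ UltraFilter U, nonprincipal U & U B].
Proof.
move=> Binf.
pose F : set_system posnat := [set C | finite_set (B `\` C)].
have PF : ProperFilter F.
  split; first by rewrite /F /= setD0.
  split.
  - by rewrite /F /= setDT.
  - by move=> C D; rewrite /F /= setDIr finite_setU.
  - move=> C D CD; apply: sub_finite_set => x [Bx Dx]; split=> // /CD.
    exact: Dx.
have [U [UU FU]] := ultraFilterLemma PF.
exists U; split=> // [a Ua|]; last by apply: FU; rewrite /F /= setDv.
have : U (~` [set a]).
  apply: FU; rewrite /F /= setDE setCK.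
  by apply: sub_finite_set (finite_set1 a) => x [].
by rewrite Ua => /principal_filterP; exact.
Qed.

(** * From infinite sets to ultrafilters *)

(** The list [l] holds the summands already chosen and [w] the blocks still to be
    used. The next summand may be any point of [B s] not used before, and these
    points form a set of [U s]; when [w] is exhausted, [l] represents a point of
    the sumset. *)
Lemma sumset_most_sums (k : nat) (k_gt0 : (0 < k)%N) (n : 'I_k -> posnat)
    (B : 'I_k -> set posnat) (U : 'I_k -> set_system posnat) (A : set nat) :
  (forall s, [/\ UltraFilter (U s), nonprincipal (U s) & U s (B s)]) ->
  sumset (fun s => distinct_sums (n s) (B s)) `<=` [set x : posnat | A x] ->
  forall w l, uniq l -> (forall p, p \in l -> B p.1 p.2) ->
    has_counts n (unzip1 l ++ w) -> most_sums U A w (total l).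
Proof.
move=> UB BA; elim=> [|s w IHw] l l_uniq lB lw /=.
  rewrite cats0 in lw.
  have l_gt0 : 0 < total l.
    case: l lw {l_uniq lB} => [/(has_counts_nil _ k_gt0)//|p l _].
    by rewrite /total big_cons addn_gt0 posnat_gt0.
  by apply: (BA (PosNat l_gt0)); apply/sumset_distinct_sumsP; exists l.
have [UU Unp UsB] := UB s.
have Unotin := nonprincipal_notin _ (unzip2 l) UU Unp.
apply: filterS2 UsB Unotin => x Bx xl /=.
have -> : total l + x = total ((s, x) :: l) by rewrite /total big_cons addnC.
apply: IHw.
- rewrite /= l_uniq andbT; apply: contra xl => sxl.
  by apply/mapP; exists (s, x).
- by move=> p; rewrite inE => /predU1P[->|/lB].
- by apply: perm_has_counts lw; rewrite perm_catC /= perm_cons perm_catC.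
Qed.

(** * From ultrafilters to infinite sets *)

(** The invariant of the construction: any selection [l'] of chosen points, if
    completed in any order [w] to the prescribed counts, still has most of its
    completed sums in [A]. Requiring it for all sublists [l'] lets later points be
    combined with an arbitrary part of the earlier ones. Distinctness is asked of
    the points without their tags, so that different blocks end up disjoint. *)
Definition extendible {k : nat} (n : 'I_k -> posnat)
    (U : 'I_k -> set_system posnat) (A : set nat)
    (l : seq ('I_k * posnat)) : Prop :=
  uniq (unzip2 l) /\
  forall l' w, subseq l' l -> has_counts n (unzip1 l' ++ w) ->
    most_sums U A w (total l').

(** For a fixed sublist [l'] and a fixed word [s :: w] completing it, the
    invariant for [l] says that [U s]-most [x] keep the property for [x] added to
    [l'], with [w] left to be completed. Only finitely many pairs [(l', w)] occur,
    because words completing a sublist have bounded length; so one [x] serves all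
    pairs, and may be chosen outside [l]. *)
Lemma extendible_cons (k : nat) (n : 'I_k -> posnat)
    (U : 'I_k -> set_system posnat) (A : set nat) (l : seq ('I_k * posnat))
    (s : 'I_k) :
  UltraFilter (U s) -> nonprincipal (U s) -> extendible n U A l ->
  exists x, extendible n U A ((s, x) :: l).
Proof.
move=> UU Unp [l_uniq lA].
have FU : Filter (U s) by exact: filter_filter.
pose N := \sum_(t < k) n t.
pose f (i : (size l).-tuple bool * N.-bseq 'I_k) : set posnat :=
  [set x | has_counts n (unzip1 (mask i.1 l) ++ s :: i.2) ->
           most_sums U A i.2 (total (mask i.1 l) + x)].
have Uf : U s [set x | forall i, f i x].
  apply: filter_forall => -[m w] /=; rewrite /f /=.
  have [lw|lw] := pselect (has_counts n (unzip1 (mask m l) ++ s :: w)).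
    by apply: filterS (lA _ _ (mask_subseq m l) lw) => x.
  by apply: filterS filterT => x.
have [x [fx xl]] :=
  filter_ex (filterI Uf (nonprincipal_notin _ (unzip2 l) UU Unp)).
exists x; split=> [|l' w]; first by rewrite /= l_uniq xl.
case: l' => [|p l'] /=.
  by move=> _; apply: (lA [::]); rewrite sub0seq.
case: ifP => [/eqP-> l'l lw|_]; last exact: lA.
have /subseqP[m /eqP m_size l'm] := l'l.
have w_size : size w <= N.
  by rewrite /N -(has_counts_size _ _ _ lw) /= size_cat -addSn leq_addl.
have := fx (Tuple m_size, Bseq w_size); rewrite /f /= -l'm /total big_cons addnC.
apply; apply: perm_has_counts lw.
by rewrite /= -cat_rcons -cat_cons perm_cat2r perm_sym perm_rcons.
Qed.

(** A selection that already has the prescribed counts is completed by the empty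
    word, where the invariant says that its sum is in [A]. The order in which [e]
    lists its entries does not affect its sum, so [e] is replaced by a sublist. *)
Lemma extendible_total (k : nat) (n : 'I_k -> posnat)
    (U : 'I_k -> set_system posnat) (A : set nat) (l e : seq ('I_k * posnat)) :
  extendible n U A l -> uniq e -> {subset e <= l} -> has_counts n (unzip1 e) ->
  A (total e).
Proof.
move=> [l_uniq lA] e_uniq el en.
have ePl : perm_eq e [seq p <- l | p \in e].
  apply: uniq_perm => //; first exact: filter_uniq (map_uniq l_uniq).
  by move=> p; rewrite mem_filter; have [/el->|] := boolP (p \in e).
have -> : total e = total [seq p <- l | p \in e] by exact: perm_big.
apply: (lA _ [::]); first exact: filter_subseq.
by rewrite cats0; apply: perm_has_counts en; exact: perm_map.
Qed.

(** The tags [t] may be prescribed in advance, since every block can be extended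
    at every stage. The newest entry comes first, hence [rev]. *)
Lemma extendible_chain (k : nat) (n : 'I_k -> posnat)
    (U : 'I_k -> set_system posnat) (A : set nat) (t : nat -> 'I_k) :
  (forall s, UltraFilter (U s) /\ nonprincipal (U s)) ->
  (forall w, has_counts n w -> most_sums U A w 0) ->
  exists x : nat -> posnat,
    forall N, extendible n U A [seq (t i, x i) | i <- rev (iota 0 N)].
Proof.
move=> Unp A0.
have step (ls : seq ('I_k * posnat) * 'I_k) : exists x,
    extendible n U A ls.1 -> extendible n U A ((ls.2, x) :: ls.1).
  have [lA|nlA] := pselect (extendible n U A ls.1).
    have [UU Us] := Unp ls.2.
    by have [x xP] := extendible_cons _ _ _ _ _ _ UU Us lA; exists x.
  by exists (PosNat (ltn0Sn 0)) => /nlA.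
have [next nextP] := choice step.
pose fix L N : seq ('I_k * posnat) :=
  if N is N'.+1 then (t N', next (L N', t N')) :: L N' else [::].
exists (fun N => next (L N, t N)) => N.
have -> : [seq (t i, next (L i, t i)) | i <- rev (iota 0 N)] = L N.
  elim: N => [//|N IHN]; rewrite -addn1 iotaD rev_cat /= add0n IHN.
  by rewrite addn1.
elim: N => [|N IHN]; last exact: nextP.
split=> // l' w; rewrite subseq0 => /eqP-> /A0; by rewrite /total big_nil.
Qed.

(** * The equivalence *)

Theorem theorem6p19 (A : set posnat) (k : nat) (k_gt0 : (0 < k)%N)
    (n : 'I_k -> posnat) :
  (exists B : 'I_k -> set posnat,
    [/\ trivIset [set: 'I_k] B,
        forall s, infinite_set (B s)
      & sumset (fun s => distinct_sums (n s) (B s)) `<=` A])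
  <->
  (exists U : 'I_k -> set_system posnat,
    [/\ injective U,
        forall s, UltraFilter (U s) /\ nonprincipal (U s)
      & (\bigcap_(phi in Phi n)
          iter_pseudo_sum
            [seq U (phi i) | i <- enum 'I_(\sum_(s < k) n s)]) A]).
Proof.
(* The partial sums of [most_sums] live in [nat]. *)
have [A' ->] : exists A' : set nat, A = [set x : posnat | A' x].
  exists [set y | exists2 x, A x & y = nat_of_posnat x].
  by apply/seteqP; split=> x /= => [Ax|[y Ay /val_inj->]]; [exists x|].
split=> [[B [B_disj B_inf BA]]|[U [_ Unp UA]]].
- have [U UB] := choice (fun s => infinite_nonprincipal _ (B_inf s)).
  exists U; split=> [s t Ust|s|]; first 2 last.
  + apply/bigcap_PhiP => // w nw.
    have := sumset_most_sums _ k_gt0 _ _ _ _ UB BA w [::].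
    by rewrite /total big_nil; exact.
  (* A common ultrafilter for two blocks would contain both of them. *)
  + have [UU _ Us] := UB s; have [_ _] := UB t; rewrite -Ust => Ut.
    by apply: B_disj => //; exact: (filter_ex (filterI Us Ut)).
  + by have [UU ? _] := UB s.
- have {}UA := (bigcap_PhiP _ k_gt0 _ _ _).1 UA.
  (* Cycling through the blocks visits each of them infinitely often. *)
  pose t N : 'I_k := Ordinal (ltn_pmod N k_gt0).
  have [x xP] := extendible_chain _ _ _ _ t Unp UA.
  have mem_x N i : i < N ->
      (t i, x i) \in [seq (t j, x j) | j <- rev (iota 0 N)].
    by move=> iN; apply/mapP; exists i; rewrite // mem_rev mem_iota.
  have x_inj : injective x.
    move=> i j xij.
    have [] := xP (maxn i j).+1; rewrite /unzip2 -map_comp map_rev rev_uniq.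
    move=> /mkseq_uniqP x_inj _.
    by apply: x_inj xij; rewrite inE ltnS ?leq_maxl ?leq_maxr.
  exists (fun s => [set x i | i in [set i | t i = s]]); split.
  + by move=> s s' _ _ [_ [[i <- <-] [j <- /x_inj->]]].
  + move=> s s_fin; apply: infinite_nat.
    have y_inj : injective (fun m => x (s + m * k)).
      move=> m m' /x_inj/addnI/eqP; rewrite eqn_pmul2r // => /eqP; exact.
    apply: sub_finite_set (finite_preimage (in2W y_inj) s_fin) => m _.
    exists (s + m * k) => //; apply/val_inj => /=.
    by rewrite addnC modnMDl modn_small.
  + move=> y /sumset_distinct_sumsP[e [e_uniq eB en yE]].
    have idx_ex p : exists i, p \in e -> p = (t i, x i).
      have [/eB[i ti xi]|pe] := boolP (p \in e); last by exists 0.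
      by exists i => _; rewrite ti xi; case: (p).
    have [idx idxP] := choice idx_ex.
    rewrite /= yE.
    have eN := xP (\max_(p <- e) (idx p).+1).
    apply: (extendible_total _ _ _ _ _ _ eN) => //.
    move=> p pe; rewrite (idxP _ pe); apply: mem_x.
    exact: (leq_bigmax_seq _ pe).
Qed.
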